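(* Let $H,K,E$ be Hilbert $\mathfrak{A}$-modules over a $C^*$-algebra $\mathfrak{A}$, and let $A\in\mathcal{L}(H,K)$ and $B\in\mathcal{L}(H,E)$ be such that $\big(\mathcal{R}(A^* ),\mathcal{R}(B^* )\big)$ is a separated pair. Then for all positive definite operators $V\in\mathcal{L}(K)$ and $W\in\mathcal{L}(E)$, $$\left(A^*VA+B^*WB\right)^{\dag}A^*V=(A^*VA)^\dag A^*V-(I_H-A^\dag A)\Pi,$$ where $\Pi\in\mathcal{L}(K,H)$ is defined by $$\Pi=(2I_H-A^\dag A-B^\dag B)^{-1}(A^*VA)^\dag A^*V.$$
   Context: $\mathcal{L}(H,K)$ is the set of adjointable operators from $H$ to $K$, $\mathcal{L}(H)=\mathcal{L}(H,H)$, $I_H$ is the identity operator on $H$, and $\mathcal{R}(\cdot)$ denotes range. A positive definite operator on $K$ is a positive operator in $\mathcal{L}(K)$ that is invertible in $\mathcal{L}(K)$. $T^\dag$ denotes the Moore-Penrose inverse of an adjointable operator $T$: the unique adjointable $X$ (if it exists) with $TXT=T$, $XTX=X$, $(TX)^*=TX$, $(XT)^*=XT$; it exists iff $\mathcal{R}(T)$ is closed. The pair $\big(\mathcal{R}(A^* ),\mathcal{R}(B^* )\big)$ is called a separated pair if $\mathcal{R}(A^* )\cap\mathcal{R}(B^* )=\{0\}$ and $\mathcal{R}(A^* )+\mathcal{R}(B^* )$ is closed in $H$. In this situation $A$, $B$, $A^*VA$ and $A^*VA+B^*WB$ have Moore-Penrose inverses and $2I_H-A^\dag A-B^\dag B$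 is invertible in $\mathcal{L}(H)$, so all the expressions in the claim are meaningful. *)

(* Defs.v *)
From HB Require Import structures.
From mathcomp Require Import all_boot all_order all_algebra.
From mathcomp Require Import all_classical all_reals all_analysis.
From mathcomp Require Import complex.

Set Implicit Arguments.
Unset Strict Implicit.
Unset Printing Implicit Defensive.

Import Order.TTheory GRing.Theory Num.Theory.
Import numFieldNormedType.Exports.

Local Open Scope classical_set_scope.
Local Open Scope ring_scope.
Local Open Scope complex_scope.

Reserved Notation "S *o T" (at level 40, left associativity).
Reserved Notation "T ^†" (at level 2, format "T ^†").

(* C*-algebras are complex and need not have a unit.  The norm of a normed
   module over R[i] takes its values in R[i]; they are nonnegative reals. *)
HB.mixin Record isCstarAlgebra (R : realType) A
    of CompleteNormedModule (R[i] : numFieldType) A := {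
  cmul : A -> A -> A;
  cstar : A -> A;
  cmulA : forall a b c, cmul a (cmul b c) = cmul (cmul a b) c;
  cmulDl : forall a b c, cmul (a + b) c = cmul a c + cmul b c;
  cmulDr : forall a b c, cmul a (b + c) = cmul a b + cmul a c;
  cmulZl : forall (k : R[i]) a b, cmul (k *: a) b = k *: cmul a b;
  cmulZr : forall (k : R[i]) a b, cmul a (k *: b) = k *: cmul a b;
  cstarK : forall a, cstar (cstar a) = a;
  cstarD : forall a b, cstar (a + b) = cstar a + cstar b;
  cstarZ : forall (k : R[i]) a, cstar (k *: a) = Num.conj k *: cstar a;
  cstarM : forall a b, cstar (cmul a b) = cmul (cstar b) (cstar a);
  cnormM : forall a b, `|cmul a b| <= `|a| * `|b|;
  cnorm_star : forall a, `|cmul (cstar a) a| = `|a| ^+ 2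
}.

#[short(type="cstarAlgType")]
HB.structure Definition CstarAlgebra (R : realType) :=
  {A of isCstarAlgebra R A & CompleteNormedModule (R[i] : numFieldType) A}.

Definition cpositive (R : realType) (A : cstarAlgType R) (a : A) : Prop :=
  exists b : A, a = cmul (cstar b) b.

(* Right modules, with an inner product that is linear in its second variable.
   The norm of the underlying Banach space is the one the inner product
   induces, so that H is complete for it. *)
HB.mixin Record isHilbertModule (R : realType) (A : cstarAlgType R) H
    of CompleteNormedModule (R[i] : numFieldType) H := {
  hact : H -> A -> H;
  hdot : H -> H -> A;
  hactDl : forall x y a, hact (x + y) a = hact x a + hact y a;
  hactDr : forall x a b, hact x (a + b) = hact x a + hact x b;
  hactA : forall x a b, hact (hact x a) b = hact x (cmul a b);
  hactZl : forall (k : R[i]) x a, hact (k *: x) a = k *: hact x a;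
  hactZr : forall (k : R[i]) x a, hact x (k *: a) = k *: hact x a;
  hdotDr : forall x y z, hdot x (y + z) = hdot x y + hdot x z;
  hdotZr : forall (k : R[i]) x y, hdot x (k *: y) = k *: hdot x y;
  hdot_act : forall x y a, hdot x (hact y a) = cmul (hdot x y) a;
  hdot_star : forall x y, hdot y x = cstar (hdot x y);
  hdot_ge0 : forall x, cpositive (hdot x x);
  hdot_eq0 : forall x, hdot x x = 0 -> x = 0;
  hnormE : forall x, `|x| ^+ 2 = `|hdot x x|
}.

#[short(type="hilbertModType")]
HB.structure Definition HilbertModule (R : realType) (A : cstarAlgType R) :=
  {H of isHilbertModule R A H & CompleteNormedModule (R[i] : numFieldType) H}.

Section HdotTheory.
Context {R : realType} {A : cstarAlgType R} {H : hilbertModType A}.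
Implicit Types x y z : H.

Lemma hdotDl x y z : hdot (x + y) z = hdot x z + hdot y z.
Proof.
by rewrite (hdot_star z) hdotDr cstarD -!(hdot_star z).
Qed.

Lemma hdot0r x : hdot x 0 = 0.
Proof. by apply: (addrI (hdot x 0)); rewrite -hdotDr !addr0. Qed.

Lemma hdotNr x y : hdot x (- y) = - hdot x y.
Proof. by apply: (addrI (hdot x y)); rewrite -hdotDr !subrr hdot0r. Qed.

Lemma hdot0l x : hdot 0 x = 0.
Proof. by apply: (addrI (hdot 0 x)); rewrite -hdotDl !addr0. Qed.

Lemma hdotNl x y : hdot (- x) y = - hdot x y.
Proof. by apply: (addrI (hdot x y)); rewrite -hdotDl !subrr hdot0l. Qed.

Lemma hdot_injl x y : (forall z, hdot x z = hdot y z) -> x = y.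
Proof.
move=> xy; apply/subr0_eq/(@hdot_eq0 _ _ H).
by rewrite hdotDl hdotNl xy subrr.
Qed.

Lemma hdot_injr x y : (forall z, hdot z x = hdot z y) -> x = y.
Proof.
by move=> xy; apply: hdot_injl => z; rewrite hdot_star xy -hdot_star.
Qed.

End HdotTheory.

(* The adjoint is stored with the operator; it is unique, so operators are
   determined by their values, see adjop_ext. *)
Record adjop (R : realType) (A : cstarAlgType R) (H K : hilbertModType A) :=
  AdjOp {
    adjop_fun :> H -> K;
    adjop_adj : K -> H;
    adjopP : forall x y, hdot (adjop_fun x) y = hdot x (adjop_adj y) }.

Section AdjOp.
Context {R : realType} {A : cstarAlgType R}.
Implicit Types H K E : hilbertModType A.

Lemma adjop_ext H K (S T : adjop H K) : S =1 T -> S = T.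
Proof.
case: S T => [f g fg] [f' g' fg'] /= /funext ff'.
move: ff' fg' => <- fg'.
have gg' : g = g' by apply/funext => y; apply: hdot_injr => x; rewrite -fg fg'.
by move: gg' fg' => <- fg'; rewrite (Prop_irrelevance fg fg').
Qed.

Fact adj_subproof H K (T : adjop H K) x y :
  hdot (adjop_adj T x) y = hdot x (T y).
Proof. by rewrite hdot_star -adjopP -hdot_star. Qed.
Definition adj H K (T : adjop H K) : adjop K H := AdjOp (adj_subproof T).

Fact idop_subproof H (x y : H) : hdot x y = hdot x y.
Proof. by []. Qed.
Definition idop H : adjop H H := AdjOp (@idop_subproof H).

Fact compop_subproof H K E (S : adjop K E) (T : adjop H K) x y :
  hdot (S (T x)) y = hdot x (adj T (adj S y)).
Proof. by rewrite !adjopP. Qed.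
Definition compop H K E (S : adjop K E) (T : adjop H K) : adjop H E :=
  AdjOp (compop_subproof S T).

Fact zeroop_subproof H K (x : H) (y : K) : hdot (0 : K) y = hdot x (0 : H).
Proof. by rewrite hdot0l hdot0r. Qed.
Definition zeroop H K : adjop H K := AdjOp (@zeroop_subproof H K).

Fact addop_subproof H K (S T : adjop H K) x y :
  hdot (S x + T x) y = hdot x (adj S y + adj T y).
Proof. by rewrite hdotDl hdotDr !adjopP. Qed.
Definition addop H K (S T : adjop H K) : adjop H K :=
  AdjOp (addop_subproof S T).

Fact oppop_subproof H K (T : adjop H K) x y :
  hdot (- T x) y = hdot x (- adj T y).
Proof. by rewrite hdotNl hdotNr adjopP. Qed.
Definition oppop H K (T : adjop H K) : adjop H K := AdjOp (oppop_subproof T).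

HB.instance Definition _ H K := gen_eqMixin (adjop H K).
HB.instance Definition _ H K := gen_choiceMixin (adjop H K).

Fact addopA H K : associative (@addop H K).
Proof. by move=> S T U; apply: adjop_ext => x /=; rewrite addrA. Qed.
Fact addopC H K : commutative (@addop H K).
Proof. by move=> S T; apply: adjop_ext => x /=; rewrite addrC. Qed.
Fact add0op H K : left_id (zeroop H K) (@addop H K).
Proof. by move=> T; apply: adjop_ext => x /=; rewrite add0r. Qed.
Fact addNop H K : left_inverse (zeroop H K) (@oppop H K) (@addop H K).
Proof. by move=> T; apply: adjop_ext => x /=; rewrite addNr. Qed.

HB.instance Definition _ H K := GRing.isZmodule.Build (adjop H K)
  (@addopA H K) (@addopC H K) (@add0op H K) (@addNop H K).

End AdjOp.

Arguments idop {R A} H.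

Notation "S *o T" := (compop S T) : ring_scope.

Section Operators.
Context {R : realType} {A : cstarAlgType R}.
Implicit Types H K E : hilbertModType A.

(* Positive elements of the C*-algebra of adjointable operators on H. *)
Definition positive_op H (T : adjop H H) : Prop :=
  exists S : adjop H H, T = adj S *o S.

Definition is_inverse H K (T : adjop H K) (S : adjop K H) : Prop :=
  S *o T = idop H /\ T *o S = idop K.

Definition positive_definite_op H (T : adjop H H) : Prop :=
  positive_op T /\ exists S : adjop H H, is_inverse T S.

Definition is_mpinv H K (T : adjop H K) (X : adjop K H) : Prop :=
  [/\ T *o X *o T = T, X *o T *o X = X,
      adj (T *o X) = T *o X & adj (X *o T) = X *o T].

(* Both inverses are unique; they are taken to be 0 if they do not exist. *)
Definition invop H K (T : adjop H K) : adjop K H :=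
  xget 0 [set S | is_inverse T S].

Definition mpinv H K (T : adjop H K) : adjop K H :=
  xget 0 [set X | is_mpinv T X].

Definition separated_pair H (X Y : set H) : Prop :=
  X `&` Y = [set 0] /\ closed [set x + y | x in X & y in Y].

End Operators.

Notation "T ^†" := (mpinv T) : ring_scope.

(* Main.v *)
(** Two facts about Hilbert modules carry the argument: an adjointable operator
    with closed range has a Moore-Penrose inverse, and both members of a
    separated pair of operator ranges are closed.  The second one comes from the
    open mapping theorem.  For the first one, the open mapping theorem bounds T^*
    below on the range F of T, and T T^* maps F onto F by the method of
    continuity along T T^* + it.  The imaginary shift keeps the uniform lower
    bound elementary: taking real parts of inner products suffices, and the
    order of the C*-algebra is not needed.  In the same spirit Cauchy-Schwarz is
    used with the constant 4, which follows from the triangle inequality.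

    For the identity, let P = A^† A, Q = B^† B, Z = ((1 - Q) P)^† and
    Z' = Q (1 - Z).  Then Z and Z' are oblique projections and Z + Z' is the
    orthogonal projection onto the sum of the ranges of P and Q.  With
    a = A^* V A and b = B^* W B one checks
    (a + b)^† = Z^* a^† Z + Z'^* b^† Z' and
    (2 - P - Q) (2 Z - 1) Z^* = P,
    and both sides of the theorem reduce to Z^* a^† A^* V. *)

Require Import Defs.
From HB Require Import structures.
From mathcomp Require Import all_boot all_order all_algebra.
From mathcomp Require Import all_classical all_reals all_analysis.
From mathcomp Require Import complex ring lra.

Set Implicit Arguments.
Unset Strict Implicit.
Unset Printing Implicit Defensive.

Import Order.TTheory GRing.Theory Num.Theory.
Import numFieldNormedType.Exports.
Local Open Scope classical_set_scope.
Local Open Scope ring_scope.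

Lemma subr_interchange (V : zmodType) (x y z t : V) :
  x - y - (z - t) = x - z - (y - t).
Proof. by rewrite opprD addrACA -opprD. Qed.

(** * Real-valued norms and geometric convergence *)

Section RealNorm.
Context {R : realType}.
Local Notation C := (R[i]%C : numFieldType).

(** Norms take values in [R[i]], whose order is partial; the real part moves all estimates to the
    total order of [R]. *)
Definition rnorm (V : normedModType C) (x : V) : R := complex.Re `|x|.

Lemma rnormE (V : normedModType C) (x : V) : `|x| = ((rnorm x)%:C)%C.
Proof. by rewrite /rnorm RRe_real// normr_real. Qed.

Lemma rnorm_ge0 (V : normedModType C) (x : V) : 0 <= rnorm x.
Proof. by rewrite -ler0c -rnormE. Qed.

Lemma rnorm0 (V : normedModType C) : rnorm (0 : V) = 0.
Proof. by rewrite /rnorm normr0. Qed.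

Lemma rnorm0_eq0 (V : normedModType C) (x : V) : rnorm x = 0 -> x = 0.
Proof. by move=> x0; apply/normr0_eq0; rewrite rnormE x0. Qed.

Lemma rnormN (V : normedModType C) (x : V) : rnorm (- x) = rnorm x.
Proof. by rewrite /rnorm normrN. Qed.

Lemma rnormD (V : normedModType C) (x y : V) :
  rnorm (x + y) <= rnorm x + rnorm y.
Proof. by rewrite -lecR rmorphD /= -!rnormE ler_normD. Qed.

Lemma rdistC (V : normedModType C) (x y : V) : rnorm (x - y) = rnorm (y - x).
Proof. by rewrite -rnormN opprB. Qed.

Lemma rnormB (V : normedModType C) (x y : V) :
  rnorm (x - y) <= rnorm x + rnorm y.
Proof. by rewrite -(rnormN y) rnormD. Qed.

Lemma rdistD (V : normedModType C) (z x y : V) :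
  rnorm (x - y) <= rnorm (x - z) + rnorm (z - y).
Proof. by have := rnormD (x - z) (z - y); rewrite addrA subrK. Qed.

Lemma rnormZ (V : normedModType C) (t : R) (x : V) :
  rnorm ((t%:C)%C *: x) = `|t| * rnorm x.
Proof.
have tE : `|(t%:C)%C : C| = ((`|t|)%:C)%C.
  by rewrite [LHS]normc_def /= expr0n addr0 sqrtr_sqr.
by apply: complexI; rewrite -rnormE normrZ tE rnormE rmorphM.
Qed.

Lemma rnormZi (V : normedModType C) (x : V) : rnorm (('i%C : C) *: x) = rnorm x.
Proof.
have iE : `|'i%C : C| = 1.
  by rewrite [LHS]normc_def /= expr0n expr1n add0r sqrtr1.
by rewrite /rnorm normrZ iE mul1r.
Qed.

Lemma rnormZ_i (V : normedModType C) (t : R) (x : V) :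
  rnorm (((t *i)%C : C) *: x) = `|t| * rnorm x.
Proof.
have -> : (t *i)%C = ('i)%C * (t%:C)%C :> C.
  by apply/eqP; rewrite eq_complex /= !mul0r !mul1r subrr add0r !eqxx.
by rewrite -scalerA rnormZi rnormZ.
Qed.

Lemma rnorm_small (V : normedModType C) (x : V) :
  (forall e, 0 < e -> rnorm x <= e) -> x = 0.
Proof.
move=> xe; apply: rnorm0_eq0; apply/eqP; rewrite eq_le rnorm_ge0 andbT.
by apply/ler_addgt0Pl => e e0; rewrite addr0 xe.
Qed.

Lemma nbhs_rnorm (V : normedModType C) (x : V) (A : set V) :
  nbhs x A -> exists2 e, 0 < e & forall y, rnorm (x - y) < e -> A y.
Proof.
move=> /nbhs_normP[e /= e0 eA]; have eE : e = ((complex.Re e)%:C)%C.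
  by rewrite RRe_real// gtr0_real.
exists (complex.Re e) => [|y xye]; first by rewrite -ltcR -eE.
by apply: eA => /=; rewrite rnormE eE ltcR.
Qed.

Lemma rball_nbhs (V : normedModType C) (x : V) e :
  0 < e -> nbhs x [set y | rnorm (x - y) < e].
Proof.
move=> e0; apply/nbhs_normP; exists ((e%:C)%C) => /=; first by rewrite ltcR.
by move=> y /=; rewrite rnormE ltcR.
Qed.

Lemma closed_rnormP (V : normedModType C) (F : set V) : closed F <->
  forall l, (forall e, 0 < e -> exists2 x, F x & rnorm (l - x) < e) -> F l.
Proof.
split=> [Fc l Fl|Fl l lF]; last first.
  by apply: Fl => e e0; have [x [Fx xe]] := lF _ (rball_nbhs l e0); exists x.
apply: Fc => B /nbhs_rnorm[e e0 eB]; have [x Fx xe] := Fl _ e0.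
by exists x; split => //; apply: eB.
Qed.

Lemma rnorm_fst (U V : normedModType C) (p : U * V) : rnorm p.1 <= rnorm p.
Proof.
rewrite -lecR -!rnormE prod_normE.
by rewrite comparable_le_max ?lexx// real_comparable.
Qed.

Lemma rnorm_snd (U V : normedModType C) (p : U * V) : rnorm p.2 <= rnorm p.
Proof.
rewrite -lecR -!rnormE prod_normE.
by rewrite comparable_le_max ?lexx ?orbT// real_comparable.
Qed.

Lemma rnorm_pair (U V : normedModType C) (p : U * V) :
  rnorm p <= rnorm p.1 + rnorm p.2.
Proof.
rewrite -lecR rmorphD /= -!rnormE prod_normE.
by rewrite comparable_ge_max ?real_comparable// lerDl lerDr !normr_ge0.
Qed.

(** A ratio at most 1/2 gives [1 / (1 - q) <= 2], whence the factor 2 in the bound on the tails. *)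
Lemma geometric_cvg (V : completeNormedModType C) (u : V ^nat) (c q : R) :
  0 <= q <= 2^-1 -> (forall n, rnorm (u n.+1 - u n) <= c * q ^+ n) ->
  exists l, forall n, rnorm (l - u n) <= 2 * c * q ^+ n.
Proof.
move=> /andP[q0 q2] uq.
have c0 : 0 <= c by have := le_trans (rnorm_ge0 _) (uq 0); rewrite expr0 mulr1.
have qn0 n : 0 <= q ^+ n by apply: exprn_ge0.
(* Keeping the subtracted term makes the induction close: its step amounts to [2 * q <= 1]. *)
have uD n m : rnorm (u (n + m)%N - u n) <= 2 * c * q ^+ n - 2 * c * q ^+ (n + m).
  elim: m => [|m IH]; first by rewrite addn0 !subrr rnorm0.
  rewrite addnS; apply: le_trans (rdistD (u (n + m)%N) _ _) _.
  apply: le_trans (lerD (uq _) IH) _; rewrite exprS.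
  have : 0 <= c * q ^+ (n + m) by rewrite mulr_ge0.
  nra.
have uB n m : (n <= m)%N -> rnorm (u m - u n) <= 2 * c * q ^+ n.
  move=> /subnKC <-; apply: le_trans (uD _ _) _.
  by rewrite gerBl !mulr_ge0.
have q_to0 (e : R) : 0 < e -> exists n, 2 * c * q ^+ n < e.
  move=> e0; have : geometric (2 * c) q @ \oo --> (0 : R).
    by apply: cvg_geometric; rewrite ger0_norm//; lra.
  move=> /cvgrPdist_lt/(_ e e0) [n _ /(_ n (leqnn _))] /=.
  rewrite sub0r normrN ger0_norm ?mulr_ge0// => ?; by exists n.
have /cauchy_cvgP/cvg_ex[l ul] : cauchy (u @ \oo).
  apply: cauchy_exP => e e0; have e1 : 0 < complex.Re e.
    by rewrite -ltcR RRe_real ?gtr0_real.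
  have [n ne] := q_to0 _ e1.
  exists (u n); exists n => // m /= nm; rewrite -ball_normE /ball_ /=.
  rewrite rnormE -[e]RRe_real ?gtr0_real// ltcR rdistC.
  exact: le_lt_trans (uB _ _ nm) ne.
exists l => n; apply/ler_addgt0Pr => e e0.
have [m _ /(_ (maxn m n))] := ul _ (rball_nbhs l e0).
rewrite /= leq_maxl => /(_ isT) lm.
apply: le_trans (rdistD (u (maxn m n)) _ _) _; rewrite addrC lerD ?(ltW lm)//.
exact: uB (leq_maxr _ _).
Qed.

End RealNorm.

(** * The open mapping theorem for closed linear relations *)

Section OpenMapping.
Context {R : realType}.
Local Notation C := (R[i]%C : numFieldType).

Definition linear_set (V : lmodType C) (F : set V) : Prop :=
  F 0 /\ forall (k : C) u v, F u -> F v -> F (k *: u + v).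

Lemma linear_setD (V : lmodType C) (F : set V) u v :
  linear_set F -> F u -> F v -> F (u + v).
Proof. by case=> _ + Fu Fv => /(_ 1 u v Fu Fv); rewrite scale1r. Qed.

Lemma linear_setZ (V : lmodType C) (F : set V) k u :
  linear_set F -> F u -> F (k *: u).
Proof. by case=> F0 + Fu => /(_ k u 0 Fu F0); rewrite addr0. Qed.

Lemma linear_setB (V : lmodType C) (F : set V) u v :
  linear_set F -> F u -> F v -> F (u - v).
Proof.
by case=> _ + Fu Fv => /(_ (-1) v u Fv Fu); rewrite scaleN1r addrC.
Qed.

(* Successive approximation: errors halve, and the corrections form a geometric
   series. *)
Lemma approx_solve (X : completeNormedModType C) (Y : normedModType C)
    (G : set (X * Y)) (F : set Y) (c : R) :
  linear_set G -> closed G -> 0 <= c ->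
  (forall y, F y -> exists2 p, G p & [/\ rnorm p.1 <= c * rnorm y,
    rnorm (y - p.2) <= rnorm y / 2 & F (y - p.2)]) ->
  forall y, F y -> exists2 x, G (x, y) & rnorm x <= 2 * c * rnorm y.
Proof.
move=> Glin Gcl c0 GF y Fy.
have /boolp.choice[p pP] z : exists q, F z -> G q /\
    [/\ rnorm q.1 <= c * rnorm z, rnorm (z - q.2) <= rnorm z / 2
      & F (z - q.2)].
  have [Fz|nFz] := pselect (F z); last by exists (0, 0).
  by have [q Gq qP] := GF _ Fz; exists q.
(* After [n] corrections [r n] is the residual and [s n] the accumulated preimage; the pair
   [(s n, y - r n)] never leaves [G]. *)
pose r n := iter n (fun z => z - (p z).2) y.
pose s n := \sum_(j < n) (p (r j)).1.
have rP n : F (r n) /\ rnorm (r n) <= 2^-1 ^+ n * rnorm y.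
  elim: n => [|n [Fr rn]]; first by rewrite expr0 mul1r.
  have [_ [_ r2 Fr']] := pP _ Fr; split=> //=.
  by apply: le_trans r2 _; rewrite exprS; lra.
have Gs n : G (s n, y - r n).
  elim: n => [|n IH]; first by rewrite /s big_ord0 subrr; case: Glin.
  have [Gp _] := pP _ (rP n).1.
  have := linear_setD Glin IH Gp; congr G.
  rewrite [LHS]surjective_pairing /= /s big_ord_recr /=; congr pair.
  by rewrite opprD opprK addrA.
have [|n|l lP] := @geometric_cvg R X s (c * rnorm y) 2^-1.
- by rewrite lexx invr_ge0 ler0n.
- rewrite /s big_ord_recr /= addrAC subrr add0r.
  have [Fr rn] := rP n; have [_ [p1 _ _]] := pP _ Fr; apply: le_trans p1 _.
  by rewrite -mulrA [rnorm y * _]mulrC ler_wpM2l.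
exists l; last first.
  by have := lP 0; rewrite /s big_ord0 subr0 expr0 mulr1 mulrA.
(* The pairs [(s n, y - r n)] converge to [(l, y)], both errors being of order [2^-n]. *)
apply: (closed_rnormP _).1 Gcl _ _ => e e0.
have K0 : 0 <= 2 * c * rnorm y + rnorm y.
  by rewrite addr_ge0 ?mulr_ge0 ?rnorm_ge0.
have [n ne] : exists n, (2 * c * rnorm y + rnorm y) * 2^-1 ^+ n < e.
  have : geometric (2 * c * rnorm y + rnorm y) 2^-1 @ \oo --> (0 : R).
    by apply: cvg_geometric; rewrite ger0_norm; lra.
  move=> /cvgrPdist_lt/(_ e e0) [n _ /(_ n (leqnn _))] /=.
  rewrite sub0r normrN ger0_norm => [?|]; first by exists n.
  by rewrite mulr_ge0 ?exprn_ge0.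
exists (s n, y - r n) => //; apply: le_lt_trans ne.
apply: le_trans (rnorm_pair _) _ => /=; rewrite subKr mulrDl.
by rewrite lerD//; [have := lP n; lra | rewrite mulrC; case: (rP n)].
Qed.

Lemma linear_set_image (U V : lmodType C) (F : set (U * V)) :
  linear_set F -> linear_set (snd @` F).
Proof.
move=> [F0 FD]; split; first by exists 0.
by move=> k _ _ [p Fp <-] [q Fq <-]; exists (k *: p + q); first exact: FD.
Qed.

(* A gliding hump: were no such constant to exist, one could pick unit vectors
   [y n] in the range that are far from the image of ever larger balls, with
   radii depending on the previous choices, and [\sum_n 4^-n y n] would have no
   preimage. *)
Lemma approx_preimage (X Y : completeNormedModType C) (G : set (X * Y)) :
  linear_set G -> closed (snd @` G) ->
  exists2 c : R, 0 <= c & forall y, (snd @` G) y ->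
    exists2 p, G p & rnorm p.1 <= c * rnorm y /\ rnorm (y - p.2) <= rnorm y / 2.
Proof.
move=> Glin Gcl; apply: contrapT => noc.
have G0 : G 0 by case: Glin.
have /boolp.choice[p pP] c : exists p : X * Y, 0 <= c -> [/\ G p, rnorm p.2 = 1 &
    forall q, G q -> rnorm q.1 <= c -> 2^-1 < rnorm (p.2 - q.2)].
  have [c0|] := leP 0 c; last by exists 0.
  apply: contrapT => nop; apply: noc; exists c => // _ [p Gp <-].
  have [p0|pn0] := eqVneq (rnorm p.2) 0.
    by exists 0 => //=; rewrite p0 (rnorm0_eq0 p0) subr0 !rnorm0 mulr0 mul0r.
  have pp : 0 < rnorm p.2 by rewrite lt_def pn0 rnorm_ge0.
  (* By homogeneity it is enough to approximate the normalized pair and to scale the result back. *)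
  have [q [Gq qc pq]] : exists q, [/\ G q, rnorm q.1 <= c &
      rnorm (((rnorm p.2)^-1%:C)%C *: p.2 - q.2) <= 2^-1].
    apply: contrapT => noq; apply: nop.
    exists (((rnorm p.2)^-1%:C)%C *: p) => _; split; first exact: linear_setZ.
      by rewrite rnormZ ger0_norm ?mulVf// invr_ge0 ltW.
    by move=> q Gq qc; rewrite ltNge; apply/negP => pq; apply: noq; exists q.
  exists (((rnorm p.2)%:C)%C *: q); first exact: linear_setZ.
  rewrite /= rnormZ gtr0_norm// mulrC ler_wpM2r ?rnorm_ge0//; split=> //.
  have -> : p.2 - ((rnorm p.2)%:C)%C *: q.2 =
      ((rnorm p.2)%:C)%C *: (((rnorm p.2)^-1%:C)%C *: p.2 - q.2).
    by rewrite scalerBr scalerA -rmorphM /= divff// rmorph1 scale1r.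
  by rewrite rnormZ gtr0_norm// ler_wpM2l// ltW.
(* The radius has to beat any fixed preimage [k] of the limit: once [|k| <= i], it bounds
   [4^i (k - u.1)]. *)
pose cc (i : nat) (u : X * Y) := (i%:R + rnorm u.1) * 4 ^+ i.
pose st n :=
  iteri n (fun i u => u + ((4^-1 ^+ i)%:C)%C *: p (cc i u)) (0 : X * Y).
have cc0 i u : 0 <= cc i u by rewrite mulr_ge0 ?exprn_ge0 ?addr_ge0 ?rnorm_ge0.
have Gst n : G (st n).
  elim: n => [//|n IH]; apply: linear_setD => //; apply: linear_setZ => //.
  by have [] := pP _ (cc0 n (st n)).
have [|n|l lP] := @geometric_cvg R Y (fun n => (st n).2) 1 4^-1.
- by lra.
- have [_ p1 _] := pP _ (cc0 n (st n)).
  rewrite /= addrAC subrr add0r rnormZ p1 ger0_norm ?mulr1 ?mul1r ?exprn_ge0//.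
have [[k l'] Gkl /= l'E] : (snd @` G) l.
  apply: (closed_rnormP _).1 Gcl _ _ => e e0.
  have : geometric 2 4^-1 @ \oo --> (0 : R).
    by apply: cvg_geometric; rewrite ger0_norm; lra.
  move=> /cvgrPdist_lt/(_ e e0) [n _ /(_ n (leqnn _))] /=.
  rewrite sub0r normrN ger0_norm ?mulr_ge0 ?exprn_ge0 // => ne.
  exists (st n).2; first by exists (st n).
  by apply: le_lt_trans ne; rewrite -[X in X * _]mulr1.
subst l'; have [n kn] : exists n, rnorm k < n%:R.
  by exists (Num.bound (rnorm k)); rewrite archi_boundP ?rnorm_ge0.
have n0 : 0 < 4 ^+ n :> R by rewrite exprn_gt0.
pose q := ((4 ^+ n)%:C)%C *: ((k, l) - st n).
have Gq : G q by apply: linear_setZ => //; apply: linear_setB.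
have qc : rnorm q.1 <= cc n (st n).
  rewrite /= rnormZ gtr0_norm// mulrC ler_wpM2r ?(ltW n0)//.
  by apply: le_trans (rnormB _ _) _; rewrite lerD2r ltW.
have [_ _ /(_ q Gq qc)] := pP _ (cc0 n (st n)).
apply/negP; rewrite -leNgt.
(* The distance from the new hump to [q.2] is [4^n] times the tail after [n.+1] terms, hence at most
   [4^n * 2 * 4^-(n+1) = 1/2]. *)
have -> : (p (cc n (st n))).2 - q.2 = ((4 ^+ n)%:C)%C *: ((st n.+1).2 - l).
  have -> : (st n.+1).2 =
    (st n).2 + ((4^-1 ^+ n)%:C)%C *: (p (cc n (st n))).2 by [].
  have qV : 4 ^+ n * 4^-1 ^+ n = 1 :> R.
    by rewrite exprVn mulfV// lt0r_neq0.
  rewrite [q.2]/= !scalerBr !scalerDr scalerA -rmorphM qV.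
  rewrite rmorph1 scale1r opprB addrCA addrA.
  by [].
rewrite rnormZ gtr0_norm// rdistC.
apply: le_trans (ler_wpM2l (ltW n0) (lP n.+1)) _.
have -> : 4 ^+ n * (2 * 1 * 4^-1 ^+ n.+1) = 2^-1 :> R.
  by rewrite exprS exprVn; field; rewrite lt0r_neq0.
by [].
Qed.

(** A relation in place of an operator lets one statement serve for a graph read backwards in
    [adjop_bounded] and for sums of ranges in [open_sum]. *)
Lemma open_mapping (X Y : completeNormedModType C) (G : set (X * Y)) :
  linear_set G -> closed G -> closed (snd @` G) ->
  exists2 c : R, 0 <= c & forall y, (snd @` G) y ->
    exists2 x, G (x, y) & rnorm x <= c * rnorm y.
Proof.
move=> Glin Gcl Rcl; have [c c0 cP] := approx_preimage Glin Rcl.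
exists (2 * c); first by rewrite mulr_ge0.
apply: (approx_solve Glin Gcl c0) => y Ry; have [p Gp [p1 p2]] := cP y Ry.
exists p => //; split=> //; apply: linear_setB Ry _; last by exists p.
exact: linear_set_image.
Qed.

End OpenMapping.

(** * Completeness of products of Banach spaces *)

Section ProductComplete.
Context {K : numFieldType} (U V : completeNormedModType K).

HB.instance Definition _ := Pointed.on (U * V)%type.

Fact prod_cauchy_cvg (F : set_system (U * V)) :
  ProperFilter F -> cauchy F -> [cvg F in (U * V)%type].
Proof.
move=> PF /cauchy_ballP Fc.
have /cauchy_cvgP/cvg_ex[u Fu] : cauchy (fst @ F).
  apply/cauchy_ballP => e e0; near_simpl.
  by apply: filterS (Fc e e0) => -[p q] [].
have /cauchy_cvgP/cvg_ex[v Fv] : cauchy (snd @ F).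
  apply/cauchy_ballP => e e0; near_simpl.
  by apply: filterS (Fc e e0) => -[p q] [].
apply/cvg_ex; exists (u, v).
have : (p.1, p.2) @[p --> F] --> (u, v) by exact: cvg_pair.
by under eq_fun do rewrite -surjective_pairing.
Qed.

HB.instance Definition _ :=
  Uniform_isComplete.Build (U * V)%type prod_cauchy_cvg.

End ProductComplete.

(** * Cauchy-Schwarz and boundedness of adjointable operators *)

Section Hilbert.
Context {R : realType} {AA : cstarAlgType R}.
Local Notation C := (R[i]%C : numFieldType).
Implicit Types H K E : hilbertModType AA.

(** The C*-identity gives [|b|^2 = |b^* b| <= |b^*| |b|], so [|b| <= |b^*|]; the involution gives
    the converse. *)
Lemma rnorm_star (a : AA) : rnorm (cstar a) = rnorm a.
Proof.
have le b : rnorm b <= rnorm (cstar b).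
  have [->|b0] := eqVneq (rnorm b) 0; first exact: rnorm_ge0.
  have bp : 0 < rnorm b by rewrite lt_def b0 rnorm_ge0.
  rewrite -(ler_pM2r bp) -expr2 -lecR rmorphXn rmorphM /= -!rnormE.
  by rewrite -cnorm_star; exact: cnormM.
by apply/eqP; rewrite eq_le le -{2}[a]cstarK le.
Qed.

Lemma rnorm_hdot H (x : H) : rnorm (hdot x x) = rnorm x ^+ 2.
Proof. by apply: complexI; rewrite rmorphXn /= -!rnormE hnormE. Qed.

Lemma hdotBr H (x y z : H) : hdot x (y - z) = hdot x y - hdot x z.
Proof. by rewrite hdotDr hdotNr. Qed.

Lemma conjc_realE (t : R) : Num.conj ((t%:C)%C : C) = (t%:C)%C.
Proof. by rewrite /Num.conj /=; apply/eqP; rewrite eq_complex /= oppr0 !eqxx. Qed.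

Lemma hdotZl H (k : C) (x y : H) : hdot (k *: x) y = Num.conj k *: hdot x y.
Proof. by rewrite hdot_star hdotZr cstarZ -hdot_star. Qed.

Lemma rnorm_add_star (a : AA) : rnorm (a + cstar a) <= 2 * rnorm a.
Proof. by apply: le_trans (rnormD _ _) _; rewrite rnorm_star; lra. Qed.

(* Polarization: [<x + ty, x + ty> - <x - ty, x - ty> = 2t (<x, y> + <y, x>)];
   optimize over the real t > 0. *)
Lemma rnorm_hdot_sym H (x y : H) :
  rnorm (hdot x y + hdot y x) <= 4 * (rnorm x * rnorm y).
Proof.
have [/rnorm0_eq0->|x0] := eqVneq (rnorm x) 0.
  by rewrite hdot0r hdot0l addr0 !rnorm0 mul0r mulr0.
have [/rnorm0_eq0->|y0] := eqVneq (rnorm y) 0.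
  by rewrite hdot0r hdot0l addr0 !rnorm0 !mulr0.
have xp : 0 < rnorm x by rewrite lt_def x0 rnorm_ge0.
have yp : 0 < rnorm y by rewrite lt_def y0 rnorm_ge0.
(* This [t] gives [t *: y] the norm of [x], so [x + z] and [x - z] have norm at most [2 |x|]. *)
pose t := rnorm x / rnorm y; have t0 : 0 < t by rewrite divr_gt0.
pose z : H := ((t%:C)%C : C) *: y.
have nz : rnorm z = rnorm x by rewrite rnormZ gtr0_norm// divfK.
have polar : hdot (x + z) (x + z) - hdot (x - z) (x - z) =
    (((2 * t)%:C)%C : C) *: (hdot x y + hdot y x).
  have -> : (((2 * t)%:C)%C : C) *: (hdot x y + hdot y x) =
      (hdot x z + hdot z x) *+ 2.
    rewrite hdotZr hdotZl conjc_realE -scalerDr rmorphM /= rmorph_nat.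
    by rewrite -scalerA scaler_nat.
  rewrite !(hdotDl, hdotDr, hdotNl, hdotNr).
  move: (hdot x x) (hdot x z) (hdot z x) (hdot z z) => a b c d.
  have -> : a + b + (c + d) = a + d + (b + c) by rewrite [c + d]addrC addrACA.
  have -> : a - b - (c - d) = a + d - (b + c).
    by rewrite opprB addrACA -opprD.
  by rewrite opprB addrC addrA subrK mulr2n.
have le1 : rnorm (hdot (x + z) (x + z)) <= 4 * rnorm x ^+ 2.
  by rewrite rnorm_hdot; have := rnormD x z; have := rnorm_ge0 (x + z); nra.
have le2 : rnorm (hdot (x - z) (x - z)) <= 4 * rnorm x ^+ 2.
  by rewrite rnorm_hdot; have := rnormB x z; have := rnorm_ge0 (x - z); nra.
have := rnormB (hdot (x + z) (x + z)) (hdot (x - z) (x - z)).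
rewrite polar rnormZ (gtr0_norm (mulr_gt0 _ t0))// => le3.
rewrite -(ler_pM2l t0).
have -> : t * (4 * (rnorm x * rnorm y)) = 4 * rnorm x ^+ 2.
  by rewrite /t; field.
by lra.
Qed.

(** Replacing [y] by [i y] turns the symmetric bound into one for [<x, y> - <y, x>]; adding the two
    bounds [2 <x, y>]. *)
Lemma rnorm_hdot_le H (x y : H) : rnorm (hdot x y) <= 4 * (rnorm x * rnorm y).
Proof.
have le1 := rnorm_hdot_sym x y.
have := rnorm_hdot_sym x (('i%C : C) *: y); rewrite rnormZi hdotZr hdotZl.
have -> : Num.conj ('i%C : C) = - 'i%C.
  by rewrite /Num.conj /=; apply/eqP; rewrite eq_complex /= oppr0 !eqxx.
rewrite scaleNr -scalerBr rnormZi => le2.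
have : rnorm ((((2 : R)%:C)%C : C) *: hdot x y) <=
    rnorm (hdot x y + hdot y x) + rnorm (hdot x y - hdot y x).
  apply: le_trans (rnormD _ _); rewrite addrACA subrr addr0 le_eqVlt.
  have -> : (((2 : R)%:C)%C : C) = 2 by exact: rmorph_nat.
  by rewrite scaler_nat mulr2n eqxx.
rewrite rnormZ gtr0_norm//; lra.
Qed.

Section Linear.
Context {H K : hilbertModType AA} (T : adjop H K).

Lemma adjop_linear (k : C) x y : T (k *: x + y) = k *: T x + T y.
Proof.
by apply: hdot_injl => z; rewrite adjopP !hdotDl !hdotZl !adjopP.
Qed.

Lemma adjop0 : T 0 = 0.
Proof. by apply: hdot_injl => z; rewrite adjopP !hdot0l. Qed.

Lemma adjopB x y : T (x - y) = T x - T y.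
Proof.
by apply: hdot_injl => z; rewrite adjopP !hdotDl !hdotNl !adjopP.
Qed.

Lemma adjopN x : T (- x) = - T x.
Proof. by rewrite -[- x]sub0r adjopB adjop0 sub0r. Qed.

Lemma adjopD x y : T (x + y) = T x + T y.
Proof. by rewrite -[y in LHS]opprK adjopB adjopN opprK. Qed.

Lemma linear_set_range : linear_set (range T).
Proof.
split; first by exists 0; rewrite ?adjop0.
by move=> k _ _ [x _ <-] [y _ <-]; exists (k *: x + y); rewrite ?adjop_linear.
Qed.

(** Closed graph theorem: the adjoint makes the graph closed, and it projects onto [H], so
    [open_mapping] bounds the only possible value [T x]. *)
Lemma adjop_bounded :
  exists2 M : R, 0 <= M & forall x, rnorm (T x) <= M * rnorm x.
Proof.
pose G := [set p : K * H | p.1 = T p.2].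
have Glin : linear_set G.
  split=> [|k [u1 u2] [v1 v2]]; first by rewrite /G/= adjop0.
  by rewrite /G/= => -> ->; rewrite adjop_linear.
have Gcl : closed G.
  apply/closed_rnormP => -[u1 u2] Gu; apply/subr0_eq => /=.
  (* The defect [z] of a limit point vanishes: comparison with a nearby point of the graph bounds
     [|z|^2] by [M * e] for every [e]. *)
  set z := u1 - T u2; pose M := 4 * (rnorm z + rnorm (adj T z)).
  have M0 : 0 <= M by rewrite mulr_ge0 ?addr_ge0 ?rnorm_ge0.
  have zM e : 0 < e -> rnorm z ^+ 2 <= M * e.
    move=> e0; have [[v1 v2] Gv ue] := Gu _ e0.
    have {}Gv : v1 = T v2 := Gv; subst v1.
    have ue1 := le_lt_trans (rnorm_fst _) ue.
    have ue2 := le_lt_trans (rnorm_snd _) ue.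
    rewrite -rnorm_hdot.
    have -> : hdot z z = hdot z (u1 - T v2) - hdot (adj T z) (u2 - v2).
      by rewrite adj_subproof -hdotBr adjopB opprB addrA subrK.
    apply: le_trans (rnormB _ _) _.
    apply: le_trans (lerD (rnorm_hdot_le _ _) (rnorm_hdot_le _ _)) _.
    rewrite /M mulrDr mulrDl !mulrA lerD// ler_wpM2l ?mulr_ge0 ?rnorm_ge0//.
      exact: ltW ue1.
    exact: ltW ue2.
  have z0 : rnorm z ^+ 2 <= 0.
    apply/ler_addgt0Pr => e e0; rewrite add0r.
    have M1 : 0 < M + 1 by rewrite ltr_wpDl.
    apply: le_trans (zM (e / (M + 1)) (divr_gt0 e0 M1)) _.
    by rewrite mulrA ler_pdivrMr// mulrC ler_wpM2l ?ltW// ltrDl.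
  by apply: rnorm0_eq0; have := rnorm_ge0 z; nra.
have snd_onto x : (snd @` G) x by exists (T x, x).
have [|c c0 cP] := open_mapping Glin Gcl.
  by apply/closed_rnormP => l _.
by exists c => // x; have [y Gy] := cP x (snd_onto x); have -> : y = T x := Gy.
Qed.

End Linear.
End Hilbert.

(** * Closed ranges and the existence of Moore-Penrose inverses *)

Section ClosedRange.
Context {R : realType} {AA : cstarAlgType R}.
Local Notation C := (R[i]%C : numFieldType).
Implicit Types H K E : hilbertModType AA.

Lemma closed_bounded_ker (V W : normedModType C) (f : V -> W) (M : R) :
  (forall u v, f (u - v) = f u - f v) ->
  (forall u, rnorm (f u) <= M * rnorm u) -> closed [set u | f u = 0].
Proof.
move=> fB fM; apply/closed_rnormP => l fl; apply: rnorm_small => e e0.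
have M0 : 0 < `|M| + 1 by rewrite ltr_wpDl.
have [u /= fu0 lu] := fl _ (divr_gt0 e0 M0).
rewrite -[f l]subr0 -fu0 -fB; apply: le_trans (fM _) _.
have := rnorm_ge0 (l - u); have := ler_norm M.
by move: lu; rewrite ltr_pdivlMr//; nra.
Qed.

Lemma closed_ker H K (T : adjop H K) : closed [set x | T x = 0].
Proof.
have [M _ TM] := adjop_bounded T.
by apply: closed_bounded_ker TM => u v; rewrite adjopB.
Qed.

(** This is [open_mapping] for [(k, e) |-> S k + U e]; it yields a decomposition with both terms
    controlled by the sum. *)
Lemma open_sum H K E (S : adjop K H) (U : adjop E H) :
  closed [set x + y | x in range S & y in range U] ->
  exists2 c : R, 0 <= c & forall k e, exists k' e',
    [/\ S k' + U e' = S k + U e, rnorm k' <= c * rnorm (S k + U e)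
      & rnorm e' <= c * rnorm (S k + U e)].
Proof.
move=> SUcl; pose G := [set p : (K * E) * H | S p.1.1 + U p.1.2 - p.2 = 0].
have Glin : linear_set G.
  split; first by rewrite /G /= !adjop0 addr0 subrr.
  move=> k [[u1 u2] u3] [[v1 v2] v3]; rewrite /G /= => /subr0_eq<- /subr0_eq<-.
  by rewrite !adjop_linear scalerDr addrACA subrr.
have Gcl : closed G.
  have [M M0 SM] := adjop_bounded S; have [N N0 UN] := adjop_bounded U.
  apply: (@closed_bounded_ker _ _ _ (M + N + 1)) => [u v|u] /=.
    by rewrite !adjopB addrACA -opprD subr_interchange.
  have u1 := rnorm_fst u; have u2 := rnorm_snd u.
  have u11 := le_trans (rnorm_fst u.1) u1.
  have u12 := le_trans (rnorm_snd u.1) u1.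
  apply: le_trans (rnormB _ _) _; apply: le_trans (lerD (rnormD _ _) u2) _.
  have := SM u.1.1; have := UN u.1.2; nra.
have GE : snd @` G = [set x + y | x in range S & y in range U].
  apply/seteqP; split=> [_ [[[k e] h] /subr0_eq/= <- <-]|].
    by exists (S k); [exists k|exists (U e); [exists e|]].
  by move=> _ [_ [k _ <-] [_ [e _ <-] <-]];
    exists ((k, e), S k + U e); rewrite /G /= ?subrr.
have [|c c0 cP] := open_mapping Glin Gcl; first by rewrite GE.
exists c => // k e; have [|[k' e'] /subr0_eq/= <- ke] := cP (S k + U e).
  by exists ((k, e), S k + U e); rewrite /G /= ?subrr.
exists k', e'; split=> //.
  exact: le_trans (rnorm_fst (k', e')) ke.
exact: le_trans (rnorm_snd (k', e')) ke.
Qed.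

(** If [S k1] is close to [l = S k + U e], then [l - S k1] has a small decomposition [S k' + U e'].
    Disjointness forces [U e' = U e], so [U e] is arbitrarily small. *)
Lemma separated_closed_range H K E (S : adjop K H) (U : adjop E H) :
  separated_pair (range S) (range U) -> closed (range S).
Proof.
move=> [disj SUcl]; have [c c0 cP] := open_sum SUcl.
have [N N0 UN] := adjop_bounded U.
apply/closed_rnormP => l lS.
have [_ [k _ <-] [_ [e _ <-] lE]] :
    [set x + y | x in range S & y in range U] l.
  apply: (closed_rnormP _).1 SUcl _ _ => d d0; have [_ [k _ <-] kd] := lS _ d0.
  by exists (S k) => //; exists (S k); [exists k|exists 0;
    [exists 0; rewrite ?adjop0|rewrite addr0]].
suff Ue0 : U e = 0 by exists k => //; rewrite -lE Ue0 addr0.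
apply: rnorm_small => d d0.
have M0 : 0 < N * c + 1 by rewrite ltr_wpDl ?mulr_ge0.
have [_ [k1 _ <-]] := lS _ (divr_gt0 d0 M0); rewrite -lE => dk.
have [k' [e' [ke' _ e'c]]] := cP (k - k1) e.
have ke : S k + U e - S k1 = S (k - k1) + U e by rewrite adjopB addrAC.
have disj0 : (range S `&` range U) (U (e - e')).
  split; last by exists (e - e').
  exists (k' - (k - k1)) => //; rewrite adjopB [in RHS]adjopB.
  by apply/eqP; rewrite subr_eq addrAC eq_sym subr_eq addrC -ke' addrC.
move: disj0; rewrite disj /= adjopB => /subr0_eq->.
apply: le_trans (UN _) _; move: dk; rewrite ke ltr_pdivlMr// => dk.
by have := rnorm_ge0 (S (k - k1) + U e); nra.
Qed.

Lemma separated_pairC H (X Y : set H) : separated_pair X Y -> separated_pair Y X.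
Proof.
move=> [XY XYc]; split; first by rewrite setIC.
congr closed: XYc; apply/seteqP; split=> _ [x Xx [y Yy <-]];
by exists y => //; exists x => //; rewrite addrC.
Qed.

Lemma hdot_adj H K (T : adjop H K) x y : hdot (T x) y = hdot x (adj T y).
Proof. exact: adjopP. Qed.

Section OneOperator.
Context {H K : hilbertModType AA} (T : adjop H K).
Context (Tcl : closed (range T)).

(** For a preimage [x] of [y] with [|x| <= c |y|] one has
    [|y|^2 = |<x, T^* y>| <= 4 c |y| |T^* y|]. *)
Lemma adj_bounded_below : exists2 c : R, 0 <= c &
  forall y, range T y -> rnorm y <= c * rnorm (adj T y).
Proof.
(* The zero operator as second summand brings a single range under [open_sum]. *)
have TTcl : closed [set x + y | x in range T & y in range (zeroop K K)].
  congr closed: Tcl; apply/seteqP; split=> [x Tx|_ [x Tx [_ [y _ <-] <-]]].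
    by exists x => //; exists 0; [exists 0|rewrite addr0].
  by rewrite /= addr0.
have [c c0 cP] := open_sum TTcl; exists (4 * c); first by rewrite mulr_ge0.
move=> _ [x0 _ <-]; have [x [e [/= + xc _]]] := cP x0 0.
move: xc; rewrite /= !addr0; set y := T x0 => xc xy.
have [y0|yn0] := eqVneq (rnorm y) 0.
  by rewrite y0 mulr_ge0 ?rnorm_ge0// mulr_ge0.
have yp : 0 < rnorm y by rewrite lt_def yn0 rnorm_ge0.
rewrite -(ler_pM2r yp) -expr2 -rnorm_hdot -[in hdot y y]xy.
rewrite -xy adjopP xy; apply: le_trans (rnorm_hdot_le _ _) _.
have := rnorm_ge0 (adj T y); nra.
Qed.

Let shift (t : R) (x : K) : K := T (adj T x) + ((t *i)%C : C) *: x.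

(* The real part of <x, TT*x + itx> is <T*x, T*x>; this replaces the operator
   inequality TT* + t >= c, which needs the order of the C*-algebra. *)
Lemma shift_bounded_below : exists2 c : R, 0 <= c &
  forall t x, range T x -> rnorm x <= c * rnorm (shift t x).
Proof.
have [c c0 cP] := adj_bounded_below.
(* Chain [|x|^2 <= c^2 |T^* x|^2] with [|T^* x|^2 <= |<x, shift t x>| <= 4 |x| |shift t x|]. *)
exists (4 * c ^+ 2) => [|t x Tx]; first by rewrite mulr_ge0 ?exprn_ge0.
have le1 : rnorm (adj T x) ^+ 2 <= rnorm (hdot x (shift t x)).
  have := rnorm_add_star (hdot x (shift t x)).
  rewrite -hdot_star /shift hdotDr hdotDl hdotZr hdotZl.
  have -> : Num.conj ((t *i)%C : C) = - ((t *i)%C : C).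
    by rewrite /Num.conj /=; apply/eqP; rewrite eq_complex /= oppr0 !eqxx.
  rewrite scaleNr addrACA subrr addr0 adjopP -(adj_subproof T) -mulr2n.
  rewrite -scaler_nat.
  have -> : 2 = (((2 : R)%:C)%C : C) by rewrite rmorph_nat.
  by rewrite rnormZ gtr0_norm// rnorm_hdot; lra.
have le2 := rnorm_hdot_le x (shift t x).
have [x0|xn0] := eqVneq (rnorm x) 0.
  by rewrite x0 mulr_ge0 ?rnorm_ge0// mulr_ge0 ?exprn_ge0.
have xp : 0 < rnorm x by rewrite lt_def xn0 rnorm_ge0.
rewrite -(ler_pM2r xp); apply: (@le_trans _ _ (c ^+ 2 * rnorm (adj T x) ^+ 2)).
  rewrite -expr2 -exprMn lerXn2r ?nnegrE ?mulr_ge0 ?rnorm_ge0 ?cP//.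
have := ler_wpM2l (exprn_ge0 2 c0) (le_trans le1 le2).
by lra.
Qed.

(** This is [approx_solve] for the graph of [f] over the closed [range T]; invariance under [f]
    keeps the errors in the range. *)
Lemma approx_surjective (f : K -> K) (M c : R) : 0 <= c ->
  (forall k x y, f (k *: x + y) = k *: f x + f y) ->
  (forall x, rnorm (f x) <= M * rnorm x) ->
  (forall x, range T x -> range T (f x)) ->
  (forall y, range T y -> exists2 x, range T x &
     rnorm x <= c * rnorm y /\ rnorm (y - f x) <= rnorm y / 2) ->
  forall y, range T y -> exists2 x, range T x & f x = y.
Proof.
move=> c0 fL fM fT fP y Ty; have Tlin := linear_set_range T.
have fB u v : f (u - v) = f u - f v.
  by rewrite addrC -scaleN1r fL scaleN1r addrC.
pose G := [set p : K * K | range T p.1 /\ f p.1 - p.2 = 0].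
have Glin : linear_set G.
  split=> [|k [u1 u2] [v1 v2]].
    by split; [case: Tlin|have := fB 0 0; rewrite /= !subrr => ->; rewrite subrr].
  rewrite /G /= => -[Tu /subr0_eq<-] [Tv /subr0_eq<-].
  by split; [case: Tlin => _ + ; apply|rewrite fL subrr].
have Gcl : closed G.
  apply: closedI.
    apply/closed_rnormP => l lT; apply: (closed_rnormP _).1 Tcl _ _ => e e0.
    have [u Tu lu] := lT _ e0; exists u.1 => //.
    exact: le_lt_trans (rnorm_fst (l - u)) lu.
  apply: (@closed_bounded_ker _ _ _ (`|M| + 1)) => [u v|u] /=.
    by rewrite fB subr_interchange.
  apply: le_trans (rnormB _ _) _; have := fM u.1; have := ler_norm M.
  have := rnorm_fst u; have := rnorm_snd u; have := normr_ge0 M.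
  have := rnorm_ge0 u.1; nra.
have [z Tz|x [Tx /subr0_eq fx] _] :=
    @approx_solve _ _ _ G (range T) c Glin Gcl c0 _ y Ty; last by exists x.
have [x Tx [xc xz]] := fP z Tz; exists (x, f x) => /=.
  by split=> //=; rewrite subrr.
by split=> //; exact: linear_setB Tlin Tz (fT _ Tx).
Qed.

Lemma gram_surjective : forall y, range T y ->
  exists2 x, range T x & T (adj T x) = y.
Proof.
have [M M0 TM] := adjop_bounded (T *o adj T).
have [c c0 cP] := shift_bounded_below.
have Tlin := linear_set_range T.
have shiftL t (k : C) x y : shift t (k *: x + y) = k *: shift t x + shift t y.
  by rewrite /shift !adjop_linear !scalerDr !scalerA [k * _]mulrC addrACA.
have shiftM t x : rnorm (shift t x) <= (M + `|t|) * rnorm x.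
  rewrite mulrDl; apply: le_trans (rnormD _ _) (lerD (TM x) _).
  by rewrite rnormZ_i.
have shiftT t x : range T x -> range T (shift t x).
  move=> Tx; apply: (linear_setD Tlin); first by exists (adj T x).
  exact: linear_setZ Tlin Tx.
pose solvable t := forall y, range T y -> exists2 x, range T x & shift t x = y.
(* The step length is uniform in [t], because [c] is; it makes [c * d <= 1/2]. *)
pose d := (2 * c + 1)^-1; have d0 : 0 < d by rewrite invr_gt0; lra.
have cd : c * d <= 2^-1 by rewrite /d ler_pdivrMr; lra.
(* An exact solution [x] at [(n+1) d] is an approximate one at [n d]: the error [i d x] has norm at
   most [c d |y| <= |y| / 2]. *)
have step n : solvable (n.+1%:R * d) -> solvable (n%:R * d).
  move=> sol; apply: (approx_surjective c0 (shiftL _) (shiftM _) (shiftT _)).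
  move=> y Ty; have [x Tx xy] := sol y Ty; exists x => //.
  have xc : rnorm x <= c * rnorm y by rewrite -xy cP.
  split=> //; rewrite -{1}xy /shift opprD addrACA subrr add0r -scalerBl.
  have -> : ((n.+1%:R * d) *i)%C - ((n%:R * d) *i)%C = (d *i)%C :> C.
    by apply/eqP; rewrite eq_complex /= subrr eqxx -mulrBl -natr1 addrAC subrr;
      rewrite add0r mul1r eqxx.
  rewrite rnormZ_i gtr0_norm//; have := rnorm_ge0 y; nra.
(* For large [t] the term [i t] dominates: [x = y / (i t)] leaves the error [T T^* x], of norm at
   most [(M / t) |y|]. *)
have base n : 2 * M < n%:R * d -> solvable (n%:R * d).
  set t := n%:R * d => Mt; have t0 : 0 < t by lra.
  have t1 : 0 <= t^-1 by rewrite invr_ge0 ltW.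
  apply: (approx_surjective t1 (shiftL _) (shiftM _) (shiftT _)) => y Ty.
  have ny : rnorm ((((- t^-1) *i)%C : C) *: y) = t^-1 * rnorm y.
    by rewrite rnormZ_i normrN ger0_norm.
  exists ((((- t^-1) *i)%C : C) *: y); first exact: linear_setZ Tlin Ty.
  rewrite ny; split=> //; rewrite /shift scalerA.
  have -> : (t *i)%C * ((- t^-1) *i)%C = 1 :> C.
    apply/eqP; rewrite eq_complex /= !mul0r !mulr0 add0r mulrN opprK.
    by rewrite divff ?addr0 ?eqxx ?lt0r_neq0.
  rewrite scale1r opprD addrCA subrr addr0 rnormN.
  apply: le_trans (TM _) _; rewrite ny mulrA mulrC ler_wpM2l ?rnorm_ge0//.
  by rewrite ler_pdivrMr//; lra.
have [n nd] : exists n : nat, 2 * M < n%:R * d.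
  exists (Num.bound (2 * M / d)); rewrite -ltr_pdivrMr//.
  by rewrite archi_boundP// divr_ge0 ?mulr_ge0// ltW.
have sol0 : solvable 0.
  rewrite -(mul0r d); elim: n {nd} (base n nd) => [//|n IH /step]; exact: IH.
move=> y Ty; have [x Tx xy] := sol0 y Ty; exists x => //.
by rewrite -xy /shift scale0r addr0.
Qed.

(** The inverse is [T^* G], where [G] inverts [T T^*] on [range T] and vanishes on its orthogonal
    complement. *)
Lemma closed_range_mpinv : exists X, is_mpinv T X.
Proof.
have Tlin := linear_set_range T.
have T0 z : range T z -> adj T z = 0 -> z = 0.
  move=> [x _ <-] Tz; apply: (@hdot_eq0 _ _ K).
  by rewrite hdot_adj Tz hdot0r.
(* Solving twice: [T T^* v = T T^* h] makes [v] the orthogonal projection of [h] onto the range, and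
   then [T T^* w = v]. *)
have /boolp.choice[G GP] h : exists w, range T w /\ adj T (T (adj T w) - h) = 0.
  have [|v Tv vh] := @gram_surjective (T (adj T h)); first by exists (adj T h).
  have [w Tw wv] := gram_surjective Tv; exists w; split=> //; rewrite wv.
  apply: (@hdot_eq0 _ _ H); rewrite adj_subproof !(adjopB, vh).
  by rewrite subrr hdot0r.
have ker_orth u z : range T u -> adj T z = 0 -> hdot u z = 0.
  by move=> [x _ <-] Tz; rewrite hdot_adj Tz hdot0r.
have Gadj h h' : hdot (G h) h' = hdot (T (adj T (G h))) (G h').
  have [Th _] := GP h; have [_ zh'] := GP h'.
  rewrite adjopP adj_subproof; apply/esym/subr0_eq.
  by rewrite -hdotBr ker_orth.
have GS h h' : hdot (G h) h' = hdot h (G h').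
  rewrite [RHS]hdot_star Gadj [in RHS]Gadj -hdot_star.
  by rewrite adjopP adj_subproof.
pose Gop : adjop K K := AdjOp GS.
have rngTTG h : range T (T (adj T (G h))) by exists (adj T (G h)).
have projS h h' : hdot (T (adj T (G h))) h' =
    hdot (T (adj T (G h))) (T (adj T (G h'))).
  apply/esym/subr0_eq; rewrite -hdotBr ker_orth//.
  by case: (GP h').
exists (adj T *o Gop); split.
- apply: adjop_ext => x /=.
  apply/subr0_eq/T0; last by case: (GP (T x)).
  by apply: (linear_setB Tlin); [exact: rngTTG|exists x].
- apply: adjop_ext => x /=; apply/subr0_eq.
  rewrite -(adjopB (adj T)).
  apply: (@hdot_eq0 _ _ H); rewrite adj_subproof adjopB adjopB.
  rewrite [X in hdot _ X]T0 ?hdot0r//; last by case: (GP (T (adj T (G x)))).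
  by apply: (linear_setB Tlin); exact: rngTTG.
- apply: adjop_ext => h; apply: hdot_injl => h'.
  rewrite adj_subproof /= projS hdot_star [in LHS]projS -hdot_star.
  by [].
- by apply: adjop_ext.
Qed.

End OneOperator.
End ClosedRange.

(** * Uniqueness and adjoints of Moore-Penrose inverses *)

Section MoorePenrose.
Context {R : realType} {AA : cstarAlgType R}.
Implicit Types H K E : hilbertModType AA.

Lemma adj_comp H K E (S : adjop K E) (T : adjop H K) :
  adj (S *o T) = adj T *o adj S.
Proof. exact: adjop_ext. Qed.

Lemma adjK H K (T : adjop H K) : adj (adj T) = T.
Proof. exact: adjop_ext. Qed.

(** [T X] and [T Y] are orthogonal projections with the same range, hence equal; likewise
    [X T = Y T]. Then [X = X T X = Y T X = Y T Y = Y]. *)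
Lemma mpinv_unique H K (T : adjop H K) (X Y : adjop K H) :
  is_mpinv T X -> is_mpinv T Y -> X = Y.
Proof.
move=> [X1 X2 X3 X4] [Y1 Y2 Y3 Y4].
have TXTY : T *o X = T *o Y.
  have e1 : T *o X = T *o Y *o (T *o X) by rewrite -[in LHS]Y1; apply: adjop_ext.
  have e2 : T *o Y = T *o X *o (T *o Y) by rewrite -[in LHS]X1; apply: adjop_ext.
  rewrite -X3 e1 adj_comp X3 Y3 -e2.
  by [].
have XTYT : X *o T = Y *o T.
  have e1 : X *o T = X *o T *o (Y *o T) by rewrite -[in LHS]Y1; apply: adjop_ext.
  have e2 : Y *o T = Y *o T *o (X *o T) by rewrite -[in LHS]X1; apply: adjop_ext.
  by rewrite -X4 e1 adj_comp X4 Y4 -e2.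
rewrite -X2 XTYT -[RHS]Y2.
by apply: adjop_ext => x /=; rewrite -[T (X x)]/((T *o X) x) TXTY.
Qed.

Lemma mpinvP H K (T : adjop H K) (X : adjop K H) : is_mpinv T X -> T^† = X.
Proof.
move=> TX; rewrite /mpinv; case: xgetP => [Y _ TY|/(_ X)//].
exact: mpinv_unique TY TX.
Qed.

Lemma invopP H K (T : adjop H K) (S : adjop K H) : is_inverse T S -> invop T = S.
Proof.
move=> TS; rewrite /invop; case: xgetP => [U _ TU|/(_ S)//].
case: TS TU => [ST TS] [UT TU].
have -> : U = U *o (T *o S) by rewrite TS; apply: adjop_ext.
have -> : U *o (T *o S) = (U *o T) *o S by apply: adjop_ext.
by rewrite UT; apply: adjop_ext.
Qed.

Lemma is_mpinv_adj H K (T : adjop H K) (X : adjop K H) :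
  is_mpinv T X -> is_mpinv (adj T) (adj X).
Proof.
move=> [X1 X2 X3 X4]; split.
- by rewrite -[in RHS]X1; apply: adjop_ext.
- by rewrite -[in RHS]X2; apply: adjop_ext.
- by rewrite -adj_comp adjK X4.
- by rewrite -adj_comp adjK X3.
Qed.

Lemma closed_range_adj_mpinv H K (T : adjop H K) :
  closed (range (adj T)) -> is_mpinv T T^†.
Proof.
move=> /closed_range_mpinv[X /is_mpinv_adj]; rewrite adjK => TX.
by rewrite (mpinvP TX).
Qed.

End MoorePenrose.

(** * The oblique projection of a separated pair *)

Section Projections.
Context {R : realType} {AA : cstarAlgType R} {H : hilbertModType AA}.
Implicit Types P Q Z D : adjop H H.

(* [Z] is the projection onto [range P] along [range Q] plus the orthogonal
   complement of the sum; it is the Moore-Penrose inverse of [(1 - Q) P]. *)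
Lemma oblique_projection P Q : adj P = P -> P *o P = P -> adj Q = Q ->
  Q *o Q = Q -> separated_pair (range P) (range Q) ->
  exists Z, [/\ Z *o P = P, P *o Z = Z, Z *o Q = 0 &
    adj (Z - Q *o Z) = Z - Q *o Z].
Proof.
move=> Pa PP Qa QQ [disj PQcl].
have PPx x : P (P x) = P x by rewrite -[in RHS]PP.
have QQx x : Q (Q x) = Q x by rewrite -[in RHS]QQ.
pose T := (idop H - Q) *o P.
have TE x : T x = P x - Q (P x) by [].
have [|Z [TZT ZTZ TZ ZT]] := @closed_range_mpinv _ _ _ _ T.
  (* [range T] is closed: it is the closed sum of the ranges cut by the kernel of [Q]. *)
  have -> : range T = [set x + y | x in range P & y in range Q] `&`
      [set x | Q x = 0].
    apply/seteqP; split=> [_ [x _ <-]|x].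
      rewrite TE /=; split; last by rewrite adjopB QQx subrr.
      exists (P x); first by exists x.
      by exists (- Q (P x)) => //; exists (- P x); rewrite ?adjopN.
    move=> [[_ [u _ <-] [_ [v _ <-] <-]] /=].
    rewrite adjopD QQx addrC => /eqP; rewrite addr_eq0 => /eqP->.
    by exists u.
  by apply: closedI => //; exact: closed_ker.
have TP0 x : T x = 0 -> P x = 0.
  rewrite TE => /subr0_eq PQ; have : (range P `&` range Q) (P x).
    by split; [exists x|exists (P x)].
  by rewrite disj.
have TZTx x : T (Z (T x)) = T x by rewrite -[in RHS]TZT.
have ZTZx x : Z (T (Z x)) = Z x by rewrite -[in RHS]ZTZ.
(* Both are orthogonal projections, and [e1] and [e2] say that their kernels agree. *)
have ZTP : Z *o T = P.
  have e1 : P *o (Z *o T) = P.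
    apply: adjop_ext => x /=; apply/subr0_eq; rewrite -adjopB; apply: TP0.
    by rewrite adjopB TZTx subrr.
  have e2 : (Z *o T) *o P = Z *o T.
    by apply: adjop_ext => x; change (Z (T (P x)) = Z (T x)); rewrite !TE PPx.
  rewrite -e2 -ZT -[in X in _ *o X]Pa.
  by rewrite -adj_comp e1.
have ZTPx x : Z (T x) = P x by rewrite -ZTP.
(* [T^* = P (1 - Q)] kills the range of [Q], and a Moore-Penrose inverse of [T] vanishes on the
   kernel of [T^*]. *)
have ZQ x : Z (Q x) = 0.
  rewrite -ZTZx; suff -> : T (Z (Q x)) = 0 by rewrite adjop0.
  have TQ : adj T (Q x) = 0.
    apply: hdot_injl => y; rewrite adj_subproof -[in Q x]Qa adj_subproof TE.
    by rewrite adjopB QQx subrr hdot0r hdot0l.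
  rewrite -[T (Z (Q x))]/((T *o Z) (Q x)) -TZ.
  by rewrite -[LHS]/(adj Z (adj T (Q x))) TQ adjop0.
exists Z; split.
- apply: adjop_ext => x /=; rewrite -[RHS]ZTPx TE adjopB ZQ subr0.
  by [].
- by apply: adjop_ext => x /=; rewrite -[in RHS]ZTZx ZTPx.
- by apply: adjop_ext => x /=; rewrite ZQ.
have PZ x : P (Z x) = Z x by rewrite -[in RHS]ZTZx ZTPx.
(* As [P Z = Z], the difference is [(1 - Q) P Z = T Z], selfadjoint by a Penrose equation. *)
have -> : Z - Q *o Z = T *o Z; last by [].
by apply: adjop_ext => x; rewrite /= !PZ.
Qed.

End Projections.

(** * The operator [2 - P - Q] and the Moore-Penrose inverse of a sum *)

Section ObliquePair.
Context {R : realType} {AA : cstarAlgType R}.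
Local Notation C := (R[i]%C : numFieldType).

(** [Z] is an idempotent onto the range of [P] that vanishes on the range of [Q]. The predicate is
    used in both orders, and selfadjointness of [Z + W] ties the two projections together. *)
Definition oblique (H : hilbertModType AA) (P Q Z : adjop H H) : Prop :=
  [/\ Z *o P = P, P *o Z = Z & Z *o Q = 0].

Section Facts.
Context {H : hilbertModType AA} {P Q Z W : adjop H H}.
Context (Pa : adj P = P) (Qa : adj Q = Q).
Context (oZ : oblique P Q Z) (oW : oblique Q P W).
Context (Na : adj (Z + W) = Z + W).

Lemma obliqueL x : Z (P x) = P x.
Proof. by case: oZ => ZP _ _; rewrite -[in RHS]ZP. Qed.

Lemma obliqueR x : P (Z x) = Z x.
Proof. by case: oZ => _ PZ _; rewrite -[in RHS]PZ. Qed.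

Lemma oblique0 x : Z (Q x) = 0.
Proof. by case: oZ => _ _ ZQ; rewrite -[LHS]/((Z *o Q) x) ZQ. Qed.

Lemma oblique_adjL x : P (adj Z x) = P x.
Proof.
by case: oZ => ZP _ _; rewrite -{1}Pa -[LHS]/((adj P *o adj Z) x) -adj_comp ZP Pa.
Qed.

Lemma oblique_adj0 x : Q (adj Z x) = 0.
Proof.
case: oZ => _ _ ZQ; rewrite -{1}Qa -[LHS]/((adj Q *o adj Z) x) -adj_comp ZQ.
by [].
Qed.

Lemma oblique_idem x : Z (Z x) = Z x.
Proof. by rewrite -[X in Z X]obliqueR obliqueL obliqueR. Qed.

End Facts.

Lemma oblique_comp0 (H : hilbertModType AA) (P Q Z W : adjop H H) x :
  oblique P Q Z -> oblique Q P W -> Z (W x) = 0.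
Proof. by move=> oZ oW; rewrite -(obliqueR oW) (oblique0 oZ). Qed.

(** Take adjoints in [Z (Z + W) = Z]. *)
Lemma oblique_sum_adj (H : hilbertModType AA) (P Q Z W : adjop H H) x :
  oblique P Q Z -> oblique Q P W -> adj (Z + W) = Z + W ->
  Z (adj Z x) + W (adj Z x) = adj Z x.
Proof.
move=> oZ oW Na; rewrite -[LHS]/((Z + W) (adj Z x)) -Na.
rewrite -[LHS]/((adj (Z + W) *o adj Z) x) -adj_comp.
suff -> : Z *o (Z + W) = Z by [].
apply: adjop_ext => y; rewrite -[LHS]/(Z (Z y + W y)) adjopD.
by rewrite (oblique_comp0 _ oZ oW) addr0 (oblique_idem oZ).
Qed.

Lemma gapE (H : hilbertModType AA) (P Q : adjop H H) x :
  (idop H *+ 2 - P - Q) x = x - P x + (x - Q x).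
Proof. by rewrite -[LHS]/(x + x - P x - Q x) -addrA addrACA. Qed.

(** With [z = Z^* w] one has [D z = 2 z - P w] and [D (Z z) = z]; subtract the first from twice the
    second. *)
Lemma gap_solve (H : hilbertModType AA) (P Q Z W : adjop H H) w :
  adj P = P -> adj Q = Q -> oblique P Q Z -> oblique Q P W ->
  adj (Z + W) = Z + W ->
  (idop H *+ 2 - P - Q) (Z (adj Z w) + Z (adj Z w) - adj Z w) = P w.
Proof.
move=> Pa Qa oZ oW Na; set D := _ - Q; set z := adj Z w.
have Dz : D z = z - P w + z.
  by rewrite gapE (oblique_adjL Pa oZ) (oblique_adj0 Qa oZ) subr0.
(* Here [D (Z z) = Z z - Q Z z], and applying [Q] to [Z z + W z = z] gives [- Q Z z = W z], because
   [Q z = 0]. *)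
have DZz : D (Z z) = z.
  rewrite gapE (obliqueR oZ) subrr add0r -[RHS](oblique_sum_adj w oZ oW Na).
  congr (_ + _); rewrite -/z.
  have : Q (Z z + W z) = Q z by rewrite (oblique_sum_adj w oZ oW Na).
  rewrite adjopD (obliqueR oW) (oblique_adj0 Qa oZ) => /eqP.
  by rewrite addr_eq0 => /eqP->; rewrite opprK.
by rewrite adjopB adjopD DZz Dz opprD opprB addrACA subrr addr0 addrC subrK.
Qed.

Fact halfop_subproof (H : hilbertModType AA) (x y : H) :
  hdot (((2^-1)%:C)%C *: x : H) y = hdot x (((2^-1)%:C)%C *: y : H).
Proof. by rewrite hdotZl hdotZr conjc_realE. Qed.

(** Operators are only added and composed here, so the factor 1/2 enters as an operator. *)
Definition halfop (H : hilbertModType AA) : adjop H H :=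
  AdjOp (@halfop_subproof H).

(** By [gap_solve] in both orders [D (Y Z) = P] and [D (Y W) = Q], so [D (1 + Y Z + Y W) = 2]. *)
Lemma gap_inverse (H : hilbertModType AA) (P Q Z W : adjop H H) :
  adj P = P -> adj Q = Q -> oblique P Q Z -> oblique Q P W ->
  adj (Z + W) = Z + W -> exists S, is_inverse (idop H *+ 2 - P - Q) S.
Proof.
move=> Pa Qa oZ oW Na.
pose Y Z : adjop H H := Z *o adj Z + Z *o adj Z - adj Z.
pose S := (idop H + (Y Z + Y W)) *o halfop H.
set D := _ - Q.
have DY1 x : D (Y Z x) = P x by exact: gap_solve oZ oW Na.
have DY2 x : D (Y W x) = Q x.
  have -> : D = idop H *+ 2 - Q - P by rewrite /D addrAC.
  by apply: gap_solve oW oZ _ => //; rewrite addrC.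
have DS : D *o S = idop H.
  apply: adjop_ext => x; set h := halfop H x.
  rewrite -[LHS]/(D (h + (Y Z h + Y W h))) adjopD adjopD DY1 DY2 gapE.
  rewrite addrACA !subrK.
  rewrite -[h + h]/(((2^-1)%:C)%C *: x + ((2^-1)%:C)%C *: x) -scalerDl -rmorphD.
  by rewrite -[2^-1]div1r -splitr rmorph1 scale1r.
have Da : adj D = D.
  by rewrite /D -[in RHS]Pa -[in RHS]Qa; apply: adjop_ext.
(* [D] is selfadjoint, so the adjoint of a right inverse is a left inverse. *)
have SD : adj S *o D = idop H.
  rewrite -[in LHS]Da -adj_comp DS; exact: adjop_ext.
have SE : S = adj S.
  have <- : adj S *o (D *o S) = adj S by rewrite DS; apply: adjop_ext.
  have -> : adj S *o (D *o S) = adj S *o D *o S by apply: adjop_ext.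
  by rewrite SD; apply: adjop_ext.
by exists S; split=> //; rewrite [in LHS]SE.
Qed.

Lemma gap_invop (H : hilbertModType AA) (P Q Z W : adjop H H) w :
  adj P = P -> adj Q = Q -> oblique P Q Z -> oblique Q P W ->
  adj (Z + W) = Z + W ->
  invop (idop H *+ 2 - P - Q) (P w) = Z (adj Z w) + Z (adj Z w) - adj Z w.
Proof.
move=> Pa Qa oZ oW Na; have [S iS] := gap_inverse Pa Qa oZ oW Na.
rewrite (invopP iS) -(gap_solve w Pa Qa oZ oW Na); case: iS => + _.
set D := _ - Q; set y := _ - _ => SD.
by rewrite -[LHS]/((S *o D) y) SD.
Qed.

(** [P] names the common value of [a g] and [g a], the orthogonal projection onto the range of
    [a]. *)
Definition selfadj_mpinv (H : hilbertModType AA) (P a g : adjop H H) : Prop :=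
  [/\ is_mpinv a g, a *o g = P, adj a = a & adj g = g].

Section SelfAdjMpinv.
Context {H : hilbertModType AA} {P a g : adjop H H} (ag : selfadj_mpinv P a g).

Lemma selfadj_mpinvL x : a (g x) = P x.
Proof. by case: ag => _ <-. Qed.

Lemma selfadj_mpinv_absl x : P (a x) = a x.
Proof. by case: ag => -[aga _ _ _] <- _ _; rewrite -[in RHS]aga. Qed.

Lemma selfadj_mpinv_adj : adj P = P.
Proof. by case: ag => -[_ _ e _] <- _ _. Qed.

Lemma selfadj_mpinvR x : g (a x) = P x.
Proof.
case: ag => _ e aa gg; rewrite -selfadj_mpinv_adj -e adj_comp aa gg.
by [].
Qed.

Lemma selfadj_mpinv_absr x : a (P x) = a x.
Proof. by rewrite -selfadj_mpinvR selfadj_mpinvL selfadj_mpinv_absl. Qed.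

Lemma selfadj_mpinv_absg x : P (g x) = g x.
Proof.
by case: ag => -[_ gag _ _] _ _ _; rewrite -selfadj_mpinvR -[in RHS]gag.
Qed.

End SelfAdjMpinv.

(** From [P Z^* = P], [Q Z^* = 0] and their mirror images, [a] and [b] each see only their own
    summand. Both products with [a + b] are then the orthogonal projection [Z + W]. *)
Lemma sum_mpinv (H : hilbertModType AA) (P Q Z W a b g h : adjop H H) :
  oblique P Q Z -> oblique Q P W -> adj (Z + W) = Z + W ->
  selfadj_mpinv P a g -> selfadj_mpinv Q b h ->
  is_mpinv (a + b) (adj Z *o g *o Z + adj W *o h *o W).
Proof.
move=> oZ oW Na ag bh.
have [Pa Qa] := (selfadj_mpinv_adj ag, selfadj_mpinv_adj bh).
set M := a + b; set X := adj Z *o g *o Z + adj W *o h *o W.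
have MX : M *o X = Z + W.
  apply: adjop_ext => x.
  rewrite -[LHS]/(a (adj Z (g (Z x)) + adj W (h (W x))) +
    b (adj Z (g (Z x)) + adj W (h (W x)))).
  rewrite -(selfadj_mpinv_absr ag) -(selfadj_mpinv_absr bh) !adjopD.
  rewrite (oblique_adjL Pa oZ) (oblique_adj0 Pa oW).
  rewrite (oblique_adj0 Qa oZ) (oblique_adjL Qa oW) !adjop0 addr0 add0r.
  rewrite (selfadj_mpinv_absr ag) (selfadj_mpinv_absr bh).
  rewrite (selfadj_mpinvL ag) (selfadj_mpinvL bh).
  by rewrite (obliqueR oZ) (obliqueR oW).
have Ma : adj M = M.
  case: ag bh => _ _ aa _ [_ _ bb _].
  by rewrite /M -[in RHS]aa -[in RHS]bb; apply: adjop_ext.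
have Xa : adj X = X.
  case: ag bh => _ _ _ gg [_ _ _ hh].
  by rewrite /X -[in RHS]gg -[in RHS]hh; apply: adjop_ext.
have XM : X *o M = Z + W.
  by rewrite -Xa -[in LHS]Ma -adj_comp MX.
split; rewrite ?MX ?XM //; apply: adjop_ext => x.
  rewrite -[LHS]/(Z (a x + b x) + W (a x + b x)) !adjopD.
  rewrite -(selfadj_mpinv_absl ag) -(selfadj_mpinv_absl bh).
  rewrite (obliqueL oZ) (obliqueL oW) (oblique0 oZ) (oblique0 oW) addr0 add0r.
  by rewrite (selfadj_mpinv_absl ag) (selfadj_mpinv_absl bh).
(* [Z + W] fixes the ranges of [Z^*] and [W^*], hence both summands of [X]. *)
set u := adj Z (g (Z x)); set v := adj W (h (W x)).
have Zu : Z u + W u = u := oblique_sum_adj _ oZ oW Na.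
have Wv : W v + Z v = v.
  by apply: (oblique_sum_adj _ oW oZ); rewrite addrC.
rewrite -[LHS]/(Z (u + v) + W (u + v)) -[RHS]/(u + v).
by rewrite (adjopD Z) (adjopD W) addrACA Zu [Z v + W v]addrC Wv.
Qed.

End ObliquePair.

(** * Moore-Penrose inverses of weighted Gram operators *)

Section Gram.
Context {R : realType} {AA : cstarAlgType R}.
Implicit Types H K E : hilbertModType AA.

Lemma closed_range_mpinvP H K (T : adjop H K) :
  closed (range T) -> is_mpinv T T^†.
Proof. by move=> /closed_range_mpinv[X TX]; rewrite (mpinvP TX). Qed.

(* With [V = S^* S], the operator [S A] has closed range because it is regular,
   with generalized inverse [A^† V^-1 S^*]. *)
Lemma gram_mpinv H K (A : adjop H K) (V : adjop K K) :
  is_mpinv A A^† -> positive_definite_op V ->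
  selfadj_mpinv (A^† *o A) (adj A *o V *o A) (adj A *o V *o A)^†.
Proof.
move=> [AXA XAX AX XA] [[S VE] [U [UV VU]]].
set X := A^† in AXA XAX AX XA *; set P := X *o A.
pose L := S *o A; pose Y := X *o U *o adj S.
have YL : Y *o L = P.
  have -> : Y *o L = X *o (U *o (adj S *o S)) *o A by apply: adjop_ext.
  by rewrite -VE UV; apply: adjop_ext.
have LP : L *o P = L.
  have -> : L *o P = S *o (A *o X *o A) by apply: adjop_ext.
  by rewrite AXA.
have Lcl : closed (range L).
  (* [L Y] is an idempotent with the range of [L], which is therefore the kernel of [1 - L Y]. *)
  have -> : range L = [set y | (idop K - L *o Y) y = 0]; last exact: closed_ker.
  have LYL : L *o Y *o L = L by rewrite -[in RHS]LP -YL; apply: adjop_ext.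
  apply/seteqP; split=> [_ [x _ <-]|y /subr0_eq/= e]; last by exists (Y y).
  by change (L x - (L *o Y *o L) x = 0); rewrite LYL subrr.
have [] := closed_range_mpinvP Lcl; set G := L^† => LGL GLG LG GL.
have GLE : G *o L = P.
  have e1 : G *o L *o P = G *o L.
    by rewrite -[in RHS]LP; apply: adjop_ext.
  have e2 : P *o (G *o L) = P.
    by rewrite -YL -[in RHS]LGL; apply: adjop_ext.
  by rewrite -GL -e1 adj_comp GL XA e2.
have aE : adj A *o V *o A = adj L *o L by rewrite VE; apply: adjop_ext.
(* As [a = L^* L], its Moore-Penrose inverse is [G G^*]. *)
have aG : adj A *o V *o A *o (G *o adj G) = P.
  rewrite aE; have -> : adj L *o L *o (G *o adj G) = adj L *o (L *o G) *o adj G.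
    by apply: adjop_ext.
  rewrite -LG adj_comp.
  have -> : adj L *o (adj G *o adj L) *o adj G = adj (G *o L *o (G *o L)).
    by apply: adjop_ext.
  have -> : G *o L *o (G *o L) = G *o L *o G *o L by apply: adjop_ext.
  by rewrite GLG GLE.
have Ga : G *o adj G *o (adj A *o V *o A) = P.
  have -> : G *o adj G *o (adj A *o V *o A) =
      adj (adj A *o V *o A *o (G *o adj G)).
    by rewrite aE; apply: adjop_ext.
  by rewrite aG.
have mpa : is_mpinv (adj A *o V *o A) (G *o adj G).
  split; rewrite ?aG ?Ga //.
    have -> : P *o (adj A *o V *o A) = adj (A *o P) *o (V *o A).
      by rewrite adj_comp XA; apply: adjop_ext.
    have -> : A *o P = A *o X *o A by apply: adjop_ext.
    by rewrite AXA; apply: adjop_ext.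
  have -> : P *o (G *o adj G) = G *o L *o G *o adj G.
    by rewrite -GLE; apply: adjop_ext.
  by rewrite GLG.
rewrite (mpinvP mpa); split=> //; last by apply: adjop_ext.
by rewrite aE; apply: adjop_ext.
Qed.

Lemma mpinv_idem H K (A : adjop H K) :
  is_mpinv A A^† -> A^† *o A *o (A^† *o A) = A^† *o A.
Proof.
by move=> [_ XAX _ _]; rewrite -[X in _ = X *o A]XAX; apply: adjop_ext.
Qed.

Lemma range_mpinv_proj H K (A : adjop H K) :
  is_mpinv A A^† -> range (A^† *o A) = range (adj A).
Proof.
move=> [AXA XAX AX XA]; apply/seteqP; split=> [_ [x _ <-]|_ [y _ <-]].
  by rewrite -XA adj_comp; exists (adj A^† x).
exists (adj A y) => //; rewrite -[RHS]/(adj A y) -XA.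
by rewrite -[LHS]/((adj (A^† *o A) *o adj A) y) -adj_comp
  (_ : A *o (A^† *o A) = A) // -[RHS]AXA; apply: adjop_ext.
Qed.

End Gram.

Theorem theorem3p20 (R : realType) (AA : cstarAlgType R)
    (H K E : hilbertModType AA) (A : adjop H K) (B : adjop H E)
    (sepAB : separated_pair (range (adj A)) (range (adj B)))
    (V : adjop K K) (W : adjop E E)
    (Vpos : positive_definite_op V) (Wpos : positive_definite_op W) :
  let Pi : adjop K H :=
    invop (idop H *+ 2 - A^† *o A - B^† *o B)
      *o (adj A *o V *o A)^† *o adj A *o V in
  (adj A *o V *o A + adj B *o W *o B)^† *o adj A *o V
  = (adj A *o V *o A)^† *o adj A *o V - (idop H - A^† *o A) *o Pi.
Proof.
move=> Pi.
have Amp := closed_range_adj_mpinv (separated_closed_range sepAB).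
have sepBA := separated_pairC sepAB.
have Bmp := closed_range_adj_mpinv (separated_closed_range sepBA).
have ag := gram_mpinv Amp Vpos; have bh := gram_mpinv Bmp Wpos.
move: sepAB; rewrite -(range_mpinv_proj Amp) -(range_mpinv_proj Bmp).
have AP : A *o (A^† *o A) = A.
  by case: Amp => e _ _ _; rewrite -[RHS]e; apply: adjop_ext.
have PP := mpinv_idem Amp; have QQ := mpinv_idem Bmp.
have [Pa Qa] := (selfadj_mpinv_adj ag, selfadj_mpinv_adj bh).
rewrite {}/Pi; set P := A^† *o A in ag AP PP Pa *.
set Q := B^† *o B in bh QQ Qa *; set a := adj A *o V *o A in ag *.
set g := a^† in ag *; set b := adj B *o W *o B in bh *.
move=> /(oblique_projection Pa PP Qa QQ)[Z [ZP PZ ZQ NZ]].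
pose Z' := Q - Q *o Z.
have oZ : oblique P Q Z by [].
have oZ' : oblique Q P Z'.
  have QQx x : Q (Q x) = Q x by rewrite -[in RHS]QQ.
  split; apply: adjop_ext => x.
  - by rewrite -[LHS]/(Q (Q x) - Q (Z (Q x))) (oblique0 oZ) (adjop0 Q) subr0.
  - by rewrite -[LHS]/(Q (Q x - Q (Z x))) adjopB !QQx.
  - by rewrite -[LHS]/(Q (P x) - Q (Z (P x))) (obliqueL oZ) subrr.
have Na : adj (Z + Z') = Z + Z'.
  (* Regrouped as [(Z - Q Z) + Q], the sum has two selfadjoint terms. *)
  have -> : Z + Z' = Z - Q *o Z + Q by rewrite /Z' addrCA addrC.
  by rewrite -[in RHS]NZ -[X in _ = _ + X]Qa; apply: adjop_ext.
rewrite (mpinvP (sum_mpinv oZ oZ' Na ag bh)); apply: adjop_ext => y.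
(* Both sides evaluate to [z]. As [u] lies in the range of [P], the summand with [Z'] and [b^†]
   drops out on the left. *)
set u := adj A (V y); set z := adj Z (g u).
have Pu : P u = u.
  by rewrite -Pa -[LHS]/((adj P *o adj A) (V y)) -adj_comp AP.
have Pgu : P (g u) = g u := selfadj_mpinv_absg ag _.
have Zu : Z u = u by rewrite -Pu (obliqueL oZ).
have Z'u : Z' u = 0 by rewrite -Pu (oblique0 oZ').
rewrite -[RHS]/(g u - (invop (idop H *+ 2 - P - Q) (g u) -
  P (invop (idop H *+ 2 - P - Q) (g u)))).
have := gap_invop (g u) Pa Qa oZ oZ' Na; rewrite Pgu -/z => ->.
(* On the right, [2 Z z - z] minus its image [2 Z z - g u] under [P] is [g u - z]. *)
rewrite (adjopB P) (adjopD P) (obliqueR oZ) (oblique_adjL Pa oZ) Pgu.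
rewrite subr_interchange subrr sub0r opprB subKr.
rewrite -[LHS]/(adj Z (g (Z u)) + adj Z' (b^† (Z' u))).
by rewrite Zu Z'u !adjop0 addr0.
Qed.
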